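(* Let $\{X_i\}_{i\in I}$ be a collection of Banach spaces having property (K). If $|I|<\mathfrak{p}$, then the $\ell^1$-sum $\left(\bigoplus_{i\in I}X_i\right)_{\ell^1}$ has property (K).
   Context: All linear spaces are real. Given a sequence $(x_n)$ in a linear space, a convex block subsequence of $(x_n)$ is a sequence $(y_k)$ of the form $y_k=\sum_{n\in I_k}a_n x_n$, where $(I_k)$ is a sequence of finite subsets of $\mathbb{N}$ with $\max(I_k)<\min(I_{k+1})$ and $(a_n)$ is a sequence of non-negative real numbers with $\sum_{n\in I_k}a_n=1$ for all $k\in\mathbb{N}$. For a Banach space $X$, the Mackey topology $\mu(X^*,X)$ on $X^*$ is the topology of uniform convergence on weakly compact subsets of $X$. A Banach space $X$ has property (K) if every $w^*$-convergent sequence in $X^*$ admits a convex block subsequence which is $\mu(X^*,X)$-convergent. The cardinal $\mathfrak{p}$ is the least cardinality of a family $\mathcal{M}$ of infinite subsets of $\mathbb{N}$ such that: $\bigcap\mathcal{N}$ is infinite for every finite subfamily $\mathcal{N}\subseteq\mathcal{M}$, and there is no infinite set $A\subseteq\mathbb{N}$ such that $A\setminus M$ is finite for all $M\in\mathcal{M}$. *)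

(* Defs.v *)
From HB Require Import structures.
From mathcomp Require Import all_boot all_order all_algebra finmap.
From mathcomp Require Import all_classical all_reals all_analysis.

Set Implicit Arguments.
Unset Strict Implicit.
Unset Printing Implicit Defensive.

Import Order.TTheory GRing.Theory Num.Theory.
Import numFieldNormedType.Exports.

Local Open Scope classical_set_scope.
Local Open Scope card_scope.
Local Open Scope ring_scope.

Section convex_block.
Variables (R : realType) (V : lmodType R).

(* The blocks [I k] are automatically nonempty, since their weights add up to
   [1]; so the first clause is max (I k) < min (I k.+1). *)
Definition convex_block_subseq (x y : nat -> V) : Prop :=
  exists (I : nat -> {fset nat}) (a : nat -> R),
    [/\ forall k m n, m \in I k -> n \in I k.+1 -> (m < n)%N,
        forall n, 0 <= a n,
        forall k, \sum_(n <- I k) a n = 1 &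
        forall k, y k = \sum_(n <- I k) a n *: x n].

End convex_block.

Section weak_topologies.
Variables (R : realType) (X : normedModType R).

Definition dual : set (X -> R) := [set f | linear f /\ continuous f].

(* The coarsest topology making every element of the dual continuous *)
Definition weak : topologicalType :=
  sup_topology (fun f : set_type dual =>
    Topological.class (initial_topology (set_val f))).

Definition weakly_compact (K : set X) : Prop := @compact weak K.

(* The weak* and Mackey topologies of the dual are the traces on [dual] of the
   topologies of [{ptws X -> R}] and [{family weakly_compact, X -> R}]. *)
Definition wstar_convergent (x : nat -> X -> R) : Prop :=
  exists2 f, dual f & {ptws, x @ \oo --> f}.

Definition mackey_convergent (x : nat -> X -> R) : Prop :=
  exists2 f, dual f & {family weakly_compact, x @ \oo --> f}.

End weak_topologies.

Definition property_K (R : realType) (X : completeNormedModType R) : Prop :=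
  forall x : nat -> X -> R, (forall n, dual (x n)) -> wstar_convergent x ->
  exists2 y, convex_block_subseq x y & mackey_convergent y.

Definition card_lt T U (A : set T) (B : set U) : bool :=
  (A #<= B) && ~~ (B #<= A).

Lemma card_le_min T (C : set (set T)) : C !=set0 ->
  exists2 A, C A & forall B, C B -> A #<= B.
Proof.
move=> [A0 CA0].
pose P (S : set (set T -> T)) := (forall s A, S s -> C A -> A (s A)) /\
  (forall s t A, S s -> S t -> C A -> s A = t A -> s = t).
have [F FP totF|S [[Sin Sinj] Smax]] := @Zorn_bigcup _ P.
  split=> [s A [U FU Us] CA|s t A [U FU Us] [V FV Vt] CA st].
    by have [/(_ s A Us CA)] := FP _ FU.
  have [UV|VU] := totF _ _ FU FV.
    by have [_ /(_ s t A)] := FP _ FV; apply => //; exact: UV.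
  by have [_ /(_ s t A)] := FP _ FU; apply => //; exact: VU.
have [[A CA AS]|nA] := pselect (exists2 A, C A & A `<=` [set s A | s in S]).
  exists A => // B CB.
  apply: (@card_le_trans _ _ _ S).
    apply/(card_le_trans (subset_card_le AS)).
    exact: card_image_le.
  have sB : {in S &, injective (fun s => s B)}.
    by move=> s t /set_mem Ss /set_mem St; exact: (Sinj s t B Ss St CB).
  rewrite -(card_le_eql (inj_card_eq sB)).
  by apply: subset_card_le => _ [s Ss <-]; exact: (Sin s B Ss CB).
have /choice[t tP] : forall A, exists x, C A -> A x /\ forall s, S s -> s A <> x.
  move=> A; have [CA|] := pselect (C A); last first.
    move=> nCA; suff [x _] : A0 !=set0 by exists x.
    apply: contrapT => /nonemptyPn A00; apply: nA; exists A0 => //.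
    by rewrite A00; exact: sub0set.
  have /existsNP[x] : ~ (A `<=` [set s A | s in S]).
    by move=> AS; apply: nA; exists A.
  move=> /not_implyP[Ax nx]; exists x => _; split => // s Ss sx.
  by apply: nx; exists s.
exfalso; apply: (Smax (S `|` [set t])).
  split; first by move=> s; left.
  move=> /(_ t (or_intror erefl)) St.
  by have [_ /(_ t St)] := tP _ CA0.
split.
  by move=> s A [Ss|->] CA; [exact: (Sin s A Ss CA)|have [] := tP _ CA].
move=> s u A [Ss|->] [Su|->] CA //.
- exact: (Sinj s u A Ss Su CA).
- by have [_ /(_ s Ss)] := tP _ CA.
- by have [_ /(_ u Su)] := tP _ CA; move=> h /esym /h.
Qed.

(* The cardinal p is the least cardinality of a family satisfying this. *)
Definition p_family (M : set (set nat)) : Prop :=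
  [/\ forall B, M B -> infinite_set B,
      forall N, N `<=` M -> finite_set N -> infinite_set (\bigcap_(B in N) B) &
      ~ exists2 A, infinite_set A & forall B, M B -> finite_set (A `\` B)].

Lemma p_family_nonempty : p_family !=set0.
Proof.
have [G [GU sG]] := @ultraFilterLemma nat \oo _.
have Ginf A : G A -> infinite_set A.
  move=> GA /finite_fsetP[F AF].
  have GcA : G (~` A).
    apply: sG; exists (\max_(k <- F) k).+1 => // m /=; rewrite AF /= => Fm mF.
    by move: Fm; rewrite ltnNge leq_bigmax_seq.
  by have [x []] := filter_ex (filterI GA GcA).
exists G; split => //.
  move=> N NG /finite_fsetP[N' N'E]; apply: Ginf.
  by rewrite N'E; apply: filter_bigI => B BN; apply: NG; rewrite N'E.
move=> [A /infiniteP/pcard_leP[f] AG].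
have finj n m : f n = f m -> n = m by apply: inj; rewrite inE.
have fA n : A (f n) by exact: funS.
have infr (g : nat -> nat) : injective g -> infinite_set [set f (g n) | n in setT].
  move=> ginj; apply/infiniteP; rewrite (card_le_eqr (inj_card_eq _))//.
  by move=> n m _ _ /finj/ginj.
have [GB|GB] := in_ultra_setVsetC [set f n.*2 | n in setT] GU.
- apply: (infr (fun n => n.*2.+1)); first by move=> n m [] /double_inj.
  apply: sub_finite_set (AG _ GB) => _ [n _ <-]; split => //.
  by move=> [m _ /finj] /(congr1 odd); rewrite /= !odd_double.
- apply: (infr (fun n => n.*2)); first exact: double_inj.
  by apply: sub_finite_set (AG _ GB) => _ [n _ <-]; split => //; apply; exists n.
Qed.

(* The library has no type of cardinals: p is represented by a family of least
   cardinality. The default [set0] is never reached, by [frakpP]. *)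
Definition frakp : set (set nat) :=
  xget set0 [set M | p_family M /\ forall M', p_family M' -> M #<= M'].

Lemma frakpP : p_family frakp /\ forall M, p_family M -> frakp #<= M.
Proof.
rewrite /frakp; case: xgetP => [M -> //|noM].
by have [M pM leM] := card_le_min p_family_nonempty; case: (noM M).
Qed.

Section esum_norm.
Variables (R : realType) (I : choiceType) (X : I -> normedModType R).
Implicit Types x y : forall i, X i.

Let S x := (\esum_(i in [set: I]) `|x i|%:E)%E.

Lemma esum_norm0 : (\esum_(i in [set: I]) `|0 : X i|%:E)%E = 0%E.
Proof. by rewrite esum1// => i _; rewrite normr0. Qed.

Lemma esum_normN x : (\esum_(i in [set: I]) `|- x i|%:E)%E = S x.
Proof. by apply: eq_esum => i _; rewrite normrN. Qed.

Lemma le_esum_normD x y :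
  (\esum_(i in [set: I]) `|x i + y i|%:E <= S x + S y)%E.
Proof.
rewrite -esumD//; apply: le_esum => i _.
by rewrite -EFinD lee_fin ler_normD.
Qed.

Lemma esum_normZ (a : R) x :
  (\esum_(i in [set: I]) `|a *: x i|%:E = `|a|%:E * S x)%E.
Proof.
rewrite /S /esum -ereal_supZl//; last first.
  by apply/set0P; exists 0%E, set0; [split|rewrite fsbig_set0].
congr ereal_sup; rewrite image_comp; apply: eq_imagel => A [finA _] /=.
rewrite ge0_mule_fsumr//.
by under eq_fsbigr do rewrite normrZ EFinM.
Qed.

Lemma esum_norm_le x (c : R) :
  (forall F : {fset I}, \sum_(i <- F) `|x i| <= c) -> (S x <= c%:E)%E.
Proof.
move=> Fc; apply: ge_ereal_sup => _ [A [/finite_fsetP[F ->] _] <-].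
by rewrite fsbig_finite//= set_fsetK sumEFin lee_fin.
Qed.

Lemma sum_norm_le_esum x (F : {fset I}) :
  ((\sum_(i <- F) `|x i|)%:E <= S x)%E.
Proof.
apply: esum_ge; exists [set` F]; first by split; [exact: finite_fset|].
by rewrite fsbig_finite//= set_fsetK sumEFin.
Qed.

End esum_norm.

Record l1sum (R : realType) (I : choiceType) (X : I -> normedModType R) :=
  L1Sum {
    l1fun :> forall i, X i ;
    l1fun_summable : (\esum_(i in [set: I]) `|l1fun i|%:E < +oo)%E }.

Section l1sum_normedModType.
Variables (R : realType) (I : choiceType) (X : I -> normedModType R).
Local Notation T := (l1sum X).
Implicit Types x y z : T.

Lemma l1sum_eqP x y : (forall i, x i = y i) -> x = y.
Proof.
case: x y => [x px] [y py] /= xy.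
have e : x = y by exact: functional_extensionality_dep.
by subst y; congr L1Sum; exact: Prop_irrelevance.
Qed.

Let summ0 : (\esum_(i in [set: I]) `|0 : X i|%:E < +oo)%E.
Proof. by rewrite esum_norm0. Qed.

Let summN x : (\esum_(i in [set: I]) `|- x i|%:E < +oo)%E.
Proof. by rewrite esum_normN; exact: l1fun_summable. Qed.

Let summD x y : (\esum_(i in [set: I]) `|x i + y i|%:E < +oo)%E.
Proof.
apply: (le_lt_trans (le_esum_normD _ _)).
by apply: lte_add_pinfty; exact: l1fun_summable.
Qed.

Let summZ (a : R) x : (\esum_(i in [set: I]) `|a *: x i|%:E < +oo)%E.
Proof.
rewrite esum_normZ; apply: lte_mul_pinfty => //.
exact: l1fun_summable.
Qed.

HB.instance Definition _ := gen_eqMixin T.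
HB.instance Definition _ := gen_choiceMixin T.

Let zero : T := L1Sum summ0.
Let opp x : T := L1Sum (summN x).
Let add x y : T := L1Sum (summD x y).
Let scale a x : T := L1Sum (summZ a x).

Let addA : associative add.
Proof. by move=> x y z; apply: l1sum_eqP => i /=; rewrite addrA. Qed.
Let addC : commutative add.
Proof. by move=> x y; apply: l1sum_eqP => i /=; rewrite addrC. Qed.
Let add0 : left_id zero add.
Proof. by move=> x; apply: l1sum_eqP => i /=; rewrite add0r. Qed.
Let addN : left_inverse zero opp add.
Proof. by move=> x; apply: l1sum_eqP => i /=; rewrite addNr. Qed.

HB.instance Definition _ := GRing.isZmodule.Build T addA addC add0 addN.

Let scaleA a b x : scale a (scale b x) = scale (a * b) x.
Proof. by apply: l1sum_eqP => i /=; rewrite scalerA. Qed.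
Let scale1 : left_id 1 scale.
Proof. by move=> x; apply: l1sum_eqP => i /=; rewrite scale1r. Qed.
Let scaleDr : right_distributive scale +%R.
Proof. by move=> a x y; apply: l1sum_eqP => i /=; rewrite scalerDr. Qed.
Let scaleDl x : {morph scale^~ x : a b / a + b}.
Proof. by move=> a b; apply: l1sum_eqP => i /=; rewrite scalerDl. Qed.

HB.instance Definition _ :=
  GRing.Zmodule_isLmodule.Build R T scaleA scale1 scaleDr scaleDl.

Definition l1norm x : R := fine (\esum_(i in [set: I]) `|x i|%:E)%E.

Lemma l1normE x : (l1norm x)%:E = (\esum_(i in [set: I]) `|x i|%:E)%E.
Proof.
rewrite fineK// ge0_fin_numE; first exact: l1fun_summable.
exact: esum_ge0.
Qed.

Let ler_l1normD x y : l1norm (x + y) <= l1norm x + l1norm y.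
Proof. by rewrite -lee_fin EFinD !l1normE; exact: le_esum_normD. Qed.

Let l1normZ (a : R) x : l1norm (a *: x) = `|a| * l1norm x.
Proof. by apply: EFin_inj; rewrite EFinM !l1normE; exact: esum_normZ. Qed.

Let l1norm0_eq0 x : l1norm x = 0 -> x = 0.
Proof.
move=> x0; apply: l1sum_eqP => i; apply/eqP; rewrite -normr_le0.
rewrite -lee_fin -[leRHS]/(0%:E) -x0 l1normE.
apply: le_trans (sum_norm_le_esum x [fset i]%fset).
by rewrite big_seq_fset1.
Qed.

Lemma l1sumDE x y i : (x + y) i = x i + y i. Proof. by []. Qed.

Lemma l1sumBE x y i : (x - y) i = x i - y i. Proof. by []. Qed.

Lemma l1sumZE (a : R) x i : (a *: x) i = a *: x i. Proof. by []. Qed.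

HB.instance Definition _ :=
  Lmodule_isNormed.Build R T ler_l1normD l1normZ l1norm0_eq0.

End l1sum_normedModType.

Section l1sum_complete.
Variables (R : realType) (I : choiceType) (X : I -> completeNormedModType R).
Local Notation T := (l1sum X).

Let cvg_sum_seq (U : Type) (F : set_system U) (FF : Filter F) (J : Type)
    (s : seq J) (f : J -> U -> R) (l : J -> R) :
  (forall j, f j u @[u --> F] --> l j) ->
  \sum_(j <- s) f j u @[u --> F] --> \sum_(j <- s) l j.
Proof.
move=> fl; elim: s => [|j s IHs].
  by under eq_fun do rewrite big_nil; rewrite big_nil; exact: cvg_cst.
by under eq_fun do rewrite big_cons; rewrite big_cons; exact: cvgD.
Qed.

Let sum_norm_le (x : T) (F : {fset I}) : \sum_(i <- F) `|x i| <= `|x|.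
Proof. by rewrite -lee_fin [leRHS]l1normE; exact: sum_norm_le_esum. Qed.

Let norm_le (x : T) i : `|x i| <= `|x|.
Proof. by have := sum_norm_le x [fset i]%fset; rewrite big_seq_fset1. Qed.

Let l1sum_cauchy_cvg (F : set_system T) : ProperFilter F -> cauchy F -> cvg F.
Proof.
move=> FF Fc.
have Fc' e : 0 < e -> exists x, F (ball x e).
  by move=> e0; have /cauchyP := Fc; apply.
have ci i : cauchy ((fun x : T => x i) @ F).
  apply: cauchy_exP => e e0; have [x Fx] := Fc' _ e0.
  exists (x i); suff: F [set y : T | ball (x i) e (y i)] by [].
  apply: filterS Fx => y; rewrite -!ball_normE /=.
  by apply: le_lt_trans; rewrite -l1sumBE; exact: norm_le.
pose l i : X i := lim ((fun x : T => x i) @ F).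
have lP i : (fun x : T => x i) @ F --> l i.
  by apply: (@cauchy_cvg (X i)); exact: ci.
have close e : 0 < e -> F [set x : T | forall G : {fset I},
    \sum_(i <- G) `|x i - l i| <= e].
  move=> e0; have e20 : 0 < e / 2 by rewrite divr_gt0.
  have [z Fz] := Fc' _ e20.
  apply: filterS (Fz) => x zx G.
  have cv : (fun y : T => \sum_(i <- G) `|x i - y i|) @ F -->
      \sum_(i <- G) `|x i - l i|.
    apply: (@cvg_sum_seq T F _ I G (fun i y => `|x i - y i|)) => i.
    apply: cvg_norm; apply: cvgB; first exact: cvg_cst.
    exact: lP.
  apply: (cvgr_to_le cv).
  apply: filterS (Fz) => y zy.
  apply: (le_trans (sum_norm_le (x - y) G)).
  have := ball_splitr zx zy; rewrite -ball_normE /=; exact: ltW.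
have [x0 x0P] := filter_ex (close 1 ltr01).
have l_summable : (\esum_(i in [set: I]) `|l i|%:E < +oo)%E.
  apply: (@le_lt_trans _ _ (`|x0| + 1)%:E%E); last by rewrite ltry.
  apply: esum_norm_le => G; apply: le_trans (lerD (sum_norm_le x0 G) (x0P G)).
  rewrite -big_split/=; apply: ler_sum => i _.
  by rewrite -{1}(subKr (x0 i) (l i)); exact: ler_normB.
apply/cvg_ex; exists (L1Sum l_summable); apply/cvgrPdist_le => e e0.
apply: filterS (close _ e0) => x xP.
rewrite distrC -lee_fin [leLHS]l1normE; exact: esum_norm_le.
Qed.

HB.instance Definition _ := Uniform_isComplete.Build T l1sum_cauchy_cvg.

End l1sum_complete.

(* Main.v *)
(* Subtracting the limit, let u_n be a weak*-null sequence of functionals on the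
   l1-sum. For each i, property (K) gives convex blocks of any convex blocks of
   the u_n that are Mackey-null on X_i; by a small perturbation their weights are
   rational, so that they live in the countable set of rational polynomials.
   Zorn's lemma assigns to each i a convex set M_i of polynomials, good for X_i,
   such that finitely many M_i always share polynomials supported arbitrarily far
   out: if some i were missing, a pseudo-intersection (|I| < p) of the M_j would
   provide a sequence from which to extract a good M_i. A last pseudo-intersection
   gives convex blocks that are Mackey-null on all X_i at once. On the l1-sum these
   are bounded (Banach-Steinhaus), and a gliding hump shows that they are
   Mackey-null there: otherwise, cutting along disjoint finite subsets of I gives
   functionals h_j with sum_j |h_j x| <= C |x| that do not tend to 0 uniformly on
   some weakly compact set, against the Schur property of l1. *)

Require Import Defs.
From HB Require Import structures.
From mathcomp Require Import all_boot all_order all_algebra finmap.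
From mathcomp Require Import all_classical all_reals all_analysis.
From mathcomp Require Import ring lra.

Set Implicit Arguments.
Unset Strict Implicit.
Unset Printing Implicit Defensive.

Import Order.TTheory GRing.Theory Num.Theory.
Import numFieldNormedType.Exports.

Local Open Scope classical_set_scope.
Local Open Scope ring_scope.

(** * The dual of a normed space *)

Section dual.
Variables (R : realType) (X : normedModType R).
Implicit Types (f g : X -> R) (x : X).

Lemma dualP f : dual f <-> linear f /\ exists C, forall x, `|f x| <= C * `|x|.
Proof.
split=> -[lf]; pose F := GRing.isLinear.Build _ _ _ _ _ lf;
  pose fl : {linear X -> R^o} := HB.pack f F.
- move=> cf; split => //.
  have /linear_boundedP : bounded_near fl (nbhs (0 : X)).
    exact/linear_bounded_continuous.
  by case/(@pinfty_ex_gt0 R) => C _ Cf; exists C.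
- move=> [C Cf]; split => //.
  suff : continuous fl by [].
  apply/linear_bounded_continuous/linear_boundedP.
  apply: filterS (nbhs_pinfty_ge (num_real C)) => r Cr x.
  by apply: (le_trans (Cf x)); apply: ler_wpM2r.
Qed.

Lemma dualD f g : dual f -> dual g -> dual (fun x => f x + g x).
Proof.
move=> /dualP[lf [C Cf]] /dualP[lg [D Dg]]; apply/dualP; split.
  by move=> a x y; rewrite lf lg scalerDr addrACA.
exists (C + D) => x; rewrite mulrDl.
by apply: (le_trans (ler_normD _ _)); apply: lerD.
Qed.

Lemma dual0 : dual (fun _ : X => 0 : R).
Proof.
apply/dualP; split=> [a x y|]; first by rewrite scaler0 addr0.
by exists 0 => x; rewrite normr0 mul0r.
Qed.

Lemma dualZ a f : dual f -> dual (fun x => a * f x).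
Proof.
move=> /dualP[lf [C Cf]]; apply/dualP; split.
  by move=> b x y; rewrite lf mulrDr !scalerAr.
exists (`|a| * C) => x; rewrite normrM -mulrA.
by apply: ler_wpM2l.
Qed.

Lemma dual_sum (J : Type) (s : seq J) (P : pred J) (F : J -> X -> R) :
  (forall j, dual (F j)) -> dual (fun x => \sum_(j <- s | P j) F j x).
Proof.
move=> dF; elim: s => [|j s IHs].
  by under eq_fun do rewrite big_nil; exact: dual0.
case Pj: (P j); under eq_fun do rewrite big_cons Pj; last exact: IHs.
exact: dualD.
Qed.

Lemma dualB f g : dual f -> dual g -> dual (fun x => f x - g x).
Proof.
move=> df dg; have -> : (fun x => f x - g x) = (fun x => f x + (- 1) * g x).
  by apply/funext => x; rewrite mulN1r.
by apply: dualD => //; apply: dualZ.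
Qed.

Lemma dual_linearB f x y : dual f -> f (x - y) = f x - f y.
Proof.
by move=> [lf _]; rewrite -scaleN1r addrC lf scaleN1r addrC.
Qed.

Lemma dual_linearD f x y : dual f -> f (x + y) = f x + f y.
Proof. by move=> [lf _]; rewrite -[x]scale1r lf !scale1r. Qed.

Lemma dual_linear0 f : dual f -> f 0 = 0.
Proof. by move=> df; rewrite -(subrr (0 : X)) dual_linearB// subrr. Qed.

Lemma dual_linear_sum f (J : Type) (s : seq J) (P : pred J) (F : J -> X) :
  dual f -> f (\sum_(j <- s | P j) F j) = \sum_(j <- s | P j) f (F j).
Proof.
move=> df; elim/big_rec2 : _ => [|j y z _ <-]; first exact: dual_linear0.
exact: dual_linearD.
Qed.

Lemma weak_continuous f : dual f -> continuous (f : weak X -> R).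
Proof.
move=> df x.
have := @cvg_sup X (set_type (@dual R X)) (fun f : set_type (@dual R X) =>
  Topological.class (initial_topology (set_val f))) (nbhs (x : weak X)) x _.
case => + _ => /(_ (@cvg_id _ _) (exist _ f (mem_set df))) xf.
have := @initial_continuous X R f x => xc A /xc; exact: xf.
Qed.

(* Weakly compact sets need not be metrizable, so sequences only have cluster
   points, tested against finitely many functionals at a time. *)
Lemma weakly_compact_cluster (K : set X) (u : nat -> X) :
  weakly_compact K -> (forall n, K (u n)) ->
  exists2 x, K x & forall (m : nat) (h : nat -> X -> R) (e : R) N,
    (forall j, dual (h j)) -> 0 < e ->
    exists2 n, (N <= n)%N & forall j, (j < m)%N -> `|h j (u n) - h j x| < e.
Proof.
move=> cK Ku.
have [|x [Kx clx]] := cK (u @ \oo) _; first by exists 0%N => // n _; exact: Ku.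
exists x => // m h e N dh e0.
pose U : set (weak X) := [set y | forall j, (j < m)%N -> `|h j y - h j x| < e].
have xU : nbhs (x : weak X) U.
  rewrite /U; elim: m {U} => [|m IHm]; first exact: (filterS _ filterT).
  have xm : nbhs (x : weak X) [set y | `|h m y - h m x| < e].
    have /cvgrPdist_lt/(_ e e0) := weak_continuous (dh m) (x := x).
    by apply: filterS => y; rewrite distrC.
  apply: filterS (filterI IHm xm) => y [yl ym] j.
  by rewrite ltnS leq_eqVlt => /predU1P[->//|]; exact: yl.
have [] := clx (u @` [set n | (N <= n)%N]) U _ xU.
  by exists N => // n Nn; exists n.
by move=> _ [[n Nn <-] Un]; exists n.
Qed.

End dual.

(** * Summable sequences of functionals *)

Section mackey_null.
Variables (R : realType) (X : normedModType R).
Implicit Types (g h : nat -> X -> R) (K : set X).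

(** The epsilon form of Mackey convergence to 0, on which all estimates are made; [mackey_cvgE] ties
    it to the topology. *)
Definition mackey_null g := forall K, weakly_compact K ->
  forall e : R, 0 < e -> \forall n \near \oo, forall x, K x -> `|g n x| <= e.

Lemma summable_tail (u : nat -> R) (C : R) : (forall n, 0 <= u n) ->
  (forall n, series u n <= C) ->
  forall e : R, 0 < e -> exists N, forall n, \sum_(N <= j < n) u j <= e.
Proof.
move=> u0 uC e e0.
have nd : nondecreasing_seq (series u) by exact: nondecreasing_series.
have cv : cvgn (series u).
  by apply: nondecreasing_is_cvgn => //; exists C => _ [n _ <-].
have /cvgrPdist_le/(_ e e0)[N _ NP] := cv.
exists N => n; have [Nn|/ltnW nN] := leqP N n; last first.
  by rewrite big_geq// ltW.
have := NP _ (leqnn N); have := nondecreasing_cvgn_le nd cv n.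
rewrite /series/= (big_cat_nat (n := N))//= => un /ler_normlW lN.
by rewrite -(lerD2l (\sum_(0 <= j < N) u j)) (le_trans un)// addrC -lerBlDr.
Qed.

(** The series converges absolutely, and the bound [C] passes from the partial sums to the limit,
    which makes the sum continuous. *)
Lemma dual_series h (C : R) : (forall j, dual (h j)) ->
  (forall x n, \sum_(0 <= j < n) `|h j x| <= C * `|x|) ->
  (forall x, cvgn (series (fun j => h j x))) /\
  dual (fun x => limn (series (fun j => h j x))).
Proof.
move=> dh hC.
have cvN x : cvgn [normed series (fun j => h j x)].
  apply: nondecreasing_is_cvgn.
    by apply: nondecreasing_series => k _ _; exact: normr_ge0.
  by exists (C * `|x|) => _ [n _ <-]; exact: hC.
have cv x : cvgn (series (fun j => h j x)) by exact: normed_cvg.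
split => //; apply/dualP; split.
  move=> a x y; apply/cvg_lim => //.
  have -> : series (fun j => h j (a *: x + y)) =
      (fun n => a * series (fun j => h j x) n + series (fun j => h j y) n).
    apply/funext => n; rewrite /series/= mulr_sumr -big_split/=.
    by apply: eq_bigr => j _; rewrite (dh j).1.
  apply: cvgD; last exact: cv.
  by apply: cvgM; [exact: cvg_cst|exact: cv].
exists C => x; apply: (le_trans (lim_series_norm _)) => //.
apply: limr_le => //; apply: nearW => n; exact: hC.
Qed.

(** The [i k] lie in consecutive disjoint intervals, so the left side selects one term from each
    interval that the right side covers. *)
Lemma subblock_sum_le (u : nat -> R) (M i : nat -> nat) : (forall n, 0 <= u n) ->
  (forall k, (M k <= i k < M k.+1)%N) ->
  forall a b, \sum_(a <= k < b) u (i k) <= \sum_(M a <= j < M b) u j.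
Proof.
move=> u0 iM a b; have [ab|/ltnW ba] := leqP a b; last first.
  by rewrite big_geq// sumr_ge0.
have Mmon k : (M k <= M k.+1)%N.
  by have /andP[Mi /ltnW] := iM k; exact: leq_trans.
have Mab k : (M a <= M (a + k)%N)%N.
  by elim: k => [|k IHk]; rewrite ?addn0// addnS (leq_trans IHk).
rewrite -(subnKC ab); elim: (b - a)%N => [|k IHk].
  by rewrite addn0 !big_geq.
rewrite addnS big_nat_recr/= ?leq_addr// [leRHS](big_cat_nat (n := M (a + k)%N))//=.
apply: lerD => //; have /andP[Mi iM1] := iM (a + k)%N.
rewrite [leRHS](big_cat_nat (n := i (a + k)%N))//=; last exact: ltnW.
by rewrite (big_ltn iM1) addrCA lerDl addr_ge0// sumr_ge0.
Qed.

(* Gliding hump: otherwise some subsequence [h (i k)] keeps a value [>= e / 2] at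
   [z k - x], while the other [h (i l)] are there negligible in total. The sum
   of the [h (i l)] is a functional that separates the [z k - x] from their
   weak cluster point, which all the [h j] annihilate. *)
Lemma summable_mackey_null h (C : R) : (forall j, dual (h j)) ->
  (forall x n, \sum_(0 <= j < n) `|h j x| <= C * `|x|) -> mackey_null h.
Proof.
move=> dh hC K cK e e0; apply: contrapT => nh.
have tail v (d : R) : 0 < d -> exists N, forall n, \sum_(N <= j < n) `|h j v| <= d.
  by apply: (@summable_tail _ (C * `|v|)) => //; exact: hC.
have /choice[p pP] : forall N, exists p : nat * X,
    [/\ (N <= p.1)%N, K p.2 & e < `|h p.1 p.2|].
  move=> N; apply: contrapT => np; apply: nh; exists N => // n /= Nn x Kx.
  rewrite leNgt; apply/negP => ex; apply: np; exists (n, x); split => //.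
have Kp n : K (p n).2 by case: (pP n).
have e20 : 0 < e / 2 by rewrite divr_gt0.
have e80 : 0 < e / 8 by rewrite divr_gt0.
have [x Kx clx] := weakly_compact_cluster cK Kp.
have [N0 N0P] := tail x (e / 2) e20.
(* [f M] is a hump beyond [M]: its index, its point and the position where the next hump may start.
   The head is at most [e / 8] for the final estimate, and at most [M.+1%:R^-1] so that each fixed
   [h j] vanishes in the limit. *)
have /choice[f fP] : forall M, exists f : nat * X * nat,
    [/\ (M <= f.1.1 < f.2)%N, K f.1.2, e / 2 <= `|h f.1.1 (f.1.2 - x)|,
     \sum_(0 <= j < M) `|h j (f.1.2 - x)| <= Num.min (e / 8) M.+1%:R^-1 &
     forall n, \sum_(f.2 <= j < n) `|h j (f.1.2 - x)| <= e / 8].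
  move=> M; pose d : R := Num.min (e / 8) M.+1%:R^-1.
  have d0 : 0 < d by rewrite lt_min divr_gt0//= invr_gt0.
  have dM0 : 0 < d / M.+1%:R by rewrite divr_gt0.
  have [n] := clx M h (d / M.+1%:R) (maxn M N0) dh dM0.
  rewrite geq_max => /andP[Mn N0n] nx; have [np _ ep] := pP n.
  have [M' M'P] := tail ((p n).2 - x) (e / 8) e80.
  exists ((p n).1, (p n).2, maxn M' (p n).1.+1); split => //=.
  - by rewrite (leq_trans Mn np) leq_max ltnSn orbT.
  (* The index [(p n).1] is at least [N0], so its term at [x] lies in a tail of sum at most
     [e / 2]. *)
  - rewrite (dual_linearB _ _ (dh _)); have hx : `|h (p n).1 x| <= e / 2.
      apply: le_trans (N0P (p n).1.+1).
      by rewrite big_nat_recr ?(leq_trans N0n)//= lerDr sumr_ge0.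
    have := lerB_dist (h (p n).1 (p n).2) (h (p n).1 x).
    by lra.
  - rewrite big_mkord; apply: (@le_trans _ _ (\sum_(j < M) d / M.+1%:R)).
      by apply: ler_sum => j _; rewrite (dual_linearB _ _ (dh _)) ltW// nx.
    rewrite sumr_const card_ord -[_ *+ _]mulr_natr -mulrA ger_pMr//.
    by rewrite mulrC ler_pdivrMr// mul1r ler_nat.
  - move=> m; apply: le_trans (M'P m); have [mM|Mm] := leqP m (maxn M' (p n).1.+1).
      by rewrite big_geq// sumr_ge0.
    rewrite [leRHS](big_cat_nat (leq_maxl M' (p n).1.+1) (ltnW Mm))/=.
    by rewrite lerDr sumr_ge0.
pose M := fix M k := if k is k'.+1 then (f (M k')).2 else 0%N.
pose i k := (f (M k)).1.1; pose z k := (f (M k)).1.2.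
have iM k : (M k <= i k < M k.+1)%N by case: (fP (M k)).
have kM k : (k <= M k)%N.
  elim: k => // k IHk; have /andP[Mi iM'] := iM k.
  by rewrite (leq_ltn_trans _ iM')// (leq_trans IHk).
have Kz k : K (z k) by case: (fP (M k)).
have [y Ky cly] := weakly_compact_cluster cK Kz.
(* Once [j < M k], the head at [z k - x] contains [h j], whose value there thus tends to 0; and
   [y - x] is a weak cluster point of the [z k - x]. *)
have hy j : h j (y - x) = 0.
  apply/eqP; rewrite -normr_le0; apply/ler_addgt0Pl => d d0; rewrite addr0.
  have d20 : 0 < d / 2 by rewrite divr_gt0.
  have [n0 _ n0P] := near_infty_natSinv_lt (PosNum d20).
  have [k kn /(_ j (ltnSn _)) zy] := cly j.+1 h _ (maxn n0 j.+1) dh d20.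
  have [_ _ _ + _] := fP (M k); rewrite le_min => /andP[_ Mk].
  move: kn; rewrite geq_max => /andP[n0k jk].
  have hz : `|h j (z k - x)| <= d / 2.
    apply: le_trans (ltW (n0P k n0k)); apply: (@le_trans _ _ (M k).+1%:R^-1).
      apply: le_trans Mk; rewrite (big_cat_nat (n := j.+1))//=;
        last exact: leq_trans (kM k).
      by rewrite big_nat_recr//= -addrA addrCA lerDl addr_ge0// sumr_ge0.
    by rewrite lef_pV2 ?posrE// ler_nat ltnS.
  have -> : h j (y - x) = h j (z k - x) - (h j (z k) - h j y).
    by rewrite !(dual_linearB _ _ (dh j)); ring.
  by apply: (le_trans (ler_normB _ _)); move: zy hz; lra.
pose g k := h (i k).
have dg k : dual (g k) by exact: dh.
have gC v n : \sum_(0 <= k < n) `|g k v| <= C * `|v|.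
  apply: le_trans (hC v (M n)).
  exact: (subblock_sum_le (fun j => normr_ge0 (h j v)) iM 0 n).
have [cvg_g dG] := dual_series dg gC; set G := (fun v => limn _) in dG.
have Gy : G (y - x) = 0.
  rewrite /G; have -> : series (fun j => g j (y - x)) = (fun=> 0).
    by apply/funext => n; rewrite /series/= big1// => k _; exact: hy.
  by rewrite lim_cst.
have [k _ /(_ 0%N isT)] := cly 1%N (fun=> G) (e / 8) 0%N (fun=> dG) e80.
rewrite -(dual_linearB _ _ dG) => Gzy.
have [_ _ hz headz tailz] := fP (M k).
(* The hump contributes at least [e / 2], all earlier and all later ones at most [e / 8] each. *)
have Glarge : e / 4 <= `|G (z k - x)|.
  rewrite /G -lim_norm//; apply: limr_ge; first exact: is_cvg_norm.
  exists k.+1 => // n /= kn; rewrite /series/= (big_cat_nat (n := k.+1))//=.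
  rewrite big_nat_recr//=.
  set S1 := \sum_(_ <= _ < k) _; set S2 := \sum_(_ <= _ < n) _.
  have S1le : `|S1| <= e / 8.
    apply: (le_trans (ler_norm_sum _ _ _)).
    apply: (le_trans (subblock_sum_le (fun j => normr_ge0 (h j (z k - x))) iM 0 k)).
    by move: headz; rewrite le_min => /andP[].
  have S2le : `|S2| <= e / 8.
    apply: (le_trans (ler_norm_sum _ _ _)).
    apply: le_trans (tailz (M n)).
    exact: (subblock_sum_le (fun j => normr_ge0 (h j (z k - x))) iM k.+1 n).
  have : `|g k (z k - x)| <= `|S1 + g k (z k - x) + S2| + `|S1| + `|S2|.
    rewrite [X in `|X| <= _](_ : _ = S1 + g k (z k - x) + S2 - S1 - S2); last by ring.
    apply: (le_trans (ler_normB _ _)); rewrite lerD2r.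
    exact: ler_normB.
  by move: S1le S2le hz; rewrite /g; lra.
(* The contradiction: [G] vanishes at [y - x], and it is below [e / 8] at [z k - y] by the choice of
   [k]. *)
have Gyx : G (z k - x) = G (z k - y).
  have -> : z k - x = (z k - y) + (y - x) by rewrite addrA subrK.
  by rewrite (dual_linearD _ _ dG) Gy addr0.
by move: Glarge Gzy; rewrite Gyx; lra.
Qed.

End mackey_null.

(** * The l1-sum *)

Lemma dual_comp (R : realType) (X Y : normedModType R) (L : X -> Y) (C : R)
    (f : Y -> R) : linear L -> (forall x, `|L x| <= C * `|x|) ->
  dual f -> dual (f \o L).
Proof.
move=> lL LC /dualP[lf [D Df]]; apply/dualP; split.
  by move=> a x y; rewrite /= lL lf.
exists (`|D| * C) => x /=; rewrite -mulrA.
apply: (le_trans (Df _)); apply: (@le_trans _ _ (`|D| * `|L x|)).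
  by rewrite ler_wpM2r// ler_norm.
by rewrite ler_wpM2l.
Qed.

(** A bounded linear map is weak-to-weak continuous, because composing it with a functional on [Y]
    gives a functional on [X]. *)
Lemma weakly_compact_image (R : realType) (X Y : normedModType R) (L : X -> Y)
    (C : R) (K : set X) : linear L -> (forall x, `|L x| <= C * `|x|) ->
  weakly_compact K -> weakly_compact (L @` K).
Proof.
move=> lL LC cK; apply: (@continuous_compact (weak X) (weak Y)) => //.
apply: continuous_subspaceT => x.
apply/cvg_sup; first exact/fmap_filter/(nbhs_filter (x : weak X)).
move=> f.
have df : dual (set_val f) by case: f => f fd; exact: set_mem fd.
apply: continuous_comp_initial => {}x.
exact: (weak_continuous (dual_comp lL LC df) (x := x)).
Qed.

Section banach_steinhaus.
Variables (R : realType) (X : completeNormedModType R).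

(** Banach-Steinhaus bounds all the [g n] by one constant on the unit ball; homogeneity makes it a
    norm bound. *)
Lemma ptws_null_bounded (g : nat -> X -> R) : (forall n, dual (g n)) ->
  (forall x, g n x @[n --> \oo] --> 0) ->
  exists2 C, 0 <= C & forall n x, `|g n x| <= C * `|x|.
Proof.
move=> dg g0.
have /(_ 1)[M MP] : uniform_bounded (range g : set (X -> R^o)).
  apply: (@Banach_Steinhauss R X R^o (range g)).
    move=> _ [n _ <-]; have /dualP[lg [C Cg]] := dg n; split => // r.
    exists (`|C| * `|r|) => x xr; apply: (le_trans (Cg x)).
    apply: (@le_trans _ _ (`|C| * `|x|)); first by rewrite ler_wpM2r// ler_norm.
    by rewrite ler_wpM2l// (le_trans xr)// ler_norm.
  move=> x; have cg : cvgn (fun n => g n x : R^o) by apply/cvg_ex; exists 0; exact: g0.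
  have bg := (ex_bound _).1 (cvg_seq_bounded cg).
  have [|M MP] := bg; first exact: (@globally_properfilter _ _ 0%N).
  by exists M => _ [n _ <-]; exact: (MP n).
have gM n x : `|x| <= 1 -> `|g n x| <= M by apply: MP; exists n.
exists M => [|n x]; first by apply: le_trans (gM 0%N 0 _); rewrite ?normr0.
have [->|x0] := eqVneq x 0.
  by rewrite (dual_linear0 (dg n)) !normr0 mulr0.
have := gM n (`|x|^-1 *: x).
rewrite -[_ *: x]addr0 (dg n).1 (dual_linear0 (dg n)) addr0 !normrZ normrV;
  last by rewrite unitfE normr_eq0.
rewrite normr_id mulVf ?normr_eq0// lexx => /(_ isT).
rewrite addr0 normrM normrV ?unitfE ?normr_eq0// normr_id.
by rewrite ler_pdivrMl ?normr_gt0// mulrC.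
Qed.

End banach_steinhaus.

(** * Embeddings of the summands and finite projections *)

Section l1single.
Variables (R : realType) (I : choiceType) (X : I -> completeNormedModType R).
Local Notation T := (l1sum X).
Implicit Types (x : T) (F G : {fset I}).

Let single_fun i (t : X i) : forall j, X j := dfwith (fun j => 0 : X j) i t.

Let sum_single_fun i (t : X i) F : \sum_(j <- F) `|single_fun t j| <= `|t|.
Proof.
have z j : j != i -> `|single_fun t j| = 0.
  by move=> ji; rewrite /single_fun dfwithout ?normr0// eq_sym.
have [iF|iF] := boolP (i \in F).
  rewrite (big_fsetD1 i iF)/= big_seq big1 => [|j].
    by rewrite addr0 /single_fun dfwithin.
  by rewrite !inE => /andP[ji _]; exact: z.
rewrite big_seq big1// => j jF; apply: z.
by apply: contraNneq iF => <-.
Qed.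

Let single_summable i (t : X i) :
  (\esum_(j in [set: I]) `|single_fun t j|%:E < +oo)%E.
Proof.
apply: (@le_lt_trans _ _ `|t|%:E); last exact: ltry.
by apply: esum_norm_le => F; exact: sum_single_fun.
Qed.

Definition l1single i (t : X i) : T := L1Sum (single_summable t).

Lemma l1single_in i (t : X i) : l1single t i = t.
Proof. exact: dfwithin. Qed.

Lemma l1single_out i (t : X i) j : i != j -> l1single t j = 0.
Proof. exact: dfwithout. Qed.

Lemma l1sum_norm_le x (c : R) :
  (forall F, \sum_(i <- F) `|x i| <= c) -> `|x| <= c.
Proof. by move=> xc; rewrite -lee_fin [leLHS]l1normE; exact: esum_norm_le. Qed.

Lemma sum_norm_le_l1sum x F : \sum_(i <- F) `|x i| <= `|x|.
Proof. by rewrite -lee_fin [leRHS]l1normE; exact: sum_norm_le_esum. Qed.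

Lemma l1sum_coord_le x i : `|x i| <= 1 * `|x|.
Proof.
by have := sum_norm_le_l1sum x [fset i]%fset; rewrite big_seq_fset1 mul1r.
Qed.

Lemma l1sum_coord_linear i : linear (fun x : T => x i).
Proof. by []. Qed.

Lemma l1single_norm_le i (t : X i) : `|l1single t| <= 1 * `|t|.
Proof. by rewrite mul1r; apply: l1sum_norm_le => F; exact: sum_single_fun. Qed.

Lemma l1single_linear i : linear (@l1single i).
Proof.
move=> a s t; apply: l1sum_eqP => j.
rewrite l1sumDE l1sumZE; have [<-|ij] := eqVneq i j.
  by rewrite !l1single_in.
by rewrite !l1single_out// scaler0 addr0.
Qed.

Lemma dual_l1single i (f : T -> R) : dual f -> dual (fun t : X i => f (l1single t)).
Proof. exact: dual_comp (@l1single_linear i) (@l1single_norm_le i). Qed.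

Definition l1proj F x : T := \sum_(i <- F) l1single (x i).

Lemma l1projE F x j : l1proj F x j = if j \in F then x j else 0.
Proof.
have e (s : seq I) : (\sum_(i <- s) l1single (x i)) j = \sum_(i <- s) l1single (x i) j.
  by elim: s => [|k s IHs]; rewrite ?big_nil// !big_cons l1sumDE IHs.
rewrite /l1proj e; case: ifPn => [jF|jF].
  rewrite (big_fsetD1 j jF) big_seq big1 => [|k].
    exact: etrans (addr0 _) (l1single_in _).
  by rewrite !inE => /andP[kj _]; rewrite l1single_out.
rewrite big_seq big1// => k kF; rewrite l1single_out//.
by apply: contraNneq jF => <-.
Qed.

Lemma sum_fsetD (V : zmodType) F G (f : I -> V) : (F `<=` G)%fset ->
  \sum_(i <- (G `\` F)%fset) f i = \sum_(i <- G) f i - \sum_(i <- F) f i.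
Proof.
move=> FG; rewrite [in RHS](big_fsetID _ (mem F) G)/=.
have -> : [fset i in G | i \in F]%fset = F.
  apply/fsetP => i; rewrite !inE/=.
  by have [iF|] := boolP (i \in F); rewrite ?andbF// (fsubsetP FG).
have -> : [fset i in G | i \notin F]%fset = (G `\` F)%fset.
  by apply/fsetP => i; rewrite !inE/= andbC.
by rewrite -[RHS]/(_ + _ - _) addrAC subrr add0r.
Qed.

(** The norm is the supremum of the finite sums of coordinate norms: once [F] comes within [e] of
    it, less than [e] remains for the other coordinates. *)
Lemma l1proj_tail x (e : R) : 0 < e ->
  exists F, forall G, (F `<=` G)%fset -> `|x - l1proj G x| <= e.
Proof.
move=> e0; have [F Fe] : exists F, `|x| - e < \sum_(i <- F) `|x i|.
  apply: contrapT => nF; have : `|x| <= `|x| - e.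
    by apply: l1sum_norm_le => F; rewrite leNgt; apply/negP => xF; apply: nF; exists F.
  lra.
exists F => G FG; apply: l1sum_norm_le => H.
have -> : \sum_(i <- H) `|(x - l1proj G x) i| =
    \sum_(i <- ((G `|` H) `\` G)%fset) `|x i|.
  rewrite fsetDUl fsetDv fset0U; rewrite -(big_fset_incl _ (fsubsetDl H G)).
    rewrite !big_seq; apply: eq_bigr => i; rewrite inE => /andP[iG _].
    by rewrite l1sumBE l1projE (negbTE iG) subr0.
  move=> i iH; rewrite inE iH andbT negbK => iG.
  by rewrite l1sumBE l1projE iG subrr normr0.
rewrite sum_fsetD ?fsubsetUl//.
have := sum_norm_le_l1sum x (G `|` H)%fset.
have : \sum_(i <- F) `|x i| <= \sum_(i <- G) `|x i|.
  by rewrite -subr_ge0 -sum_fsetD// sumr_ge0.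
by move: Fe; lra.
Qed.

Lemma dual_l1projE F x (f : T -> R) : dual f ->
  f (l1proj F x) = \sum_(i <- F) f (l1single (x i)).
Proof. exact: dual_linear_sum. Qed.

End l1single.

(** * From the summands to the l1-sum: the gliding hump *)

Section l1sum_mackey_null.
Variables (R : realType) (I : choiceType) (X : I -> completeNormedModType R).
Variable g : nat -> l1sum X -> R.
Hypothesis dg : forall n, dual (g n).
Hypothesis g0 : forall x, g n x @[n --> \oo] --> 0.
Hypothesis gX : forall i, mackey_null (fun n (t : X i) => g n (l1single t)).

(** Each coordinate map carries [K] to a weakly compact set of [X i], where [gX] applies; finitely
    many coordinates are then added up. *)
Lemma l1proj_mackey_null F : mackey_null (fun n x => g n (l1proj F x)).
Proof.
move=> K cK; under eq_forall do under eq_forall do under eq_near do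
  under eq_forall do rewrite dual_l1projE//.
elim: (enum_fset F) => [|i s IHs] e e0.
  by apply: nearW => n x _; rewrite big_nil normr0 ltW.
have e20 : 0 < e / 2 by rewrite divr_gt0.
have cKi := weakly_compact_image (@l1sum_coord_linear _ _ X i)
  (fun x => l1sum_coord_le x i) cK.
have := gX cKi e20; apply: filterS2 (IHs _ e20) => n sn gn x Kx.
rewrite big_cons (le_trans (ler_normD _ _))// (splitr e) lerD//; last exact: sn.
by apply: gn; exists x.
Qed.

Lemma l1sum_mackey_null : mackey_null g.
Proof.
move=> K cK e e0; apply: contrapT => ng.
have [C C0 gC] := ptws_null_bounded dg g0.
have e40 : 0 < e / 4 by rewrite divr_gt0.
(* [f F] is a larger finite set, an index and a point of [K]. The value at the point exceeds [e];
   the part in [F] and the part outside the larger set take at most [e / 4] each, which leaves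
   [e / 2] in between. *)
have /choice[f fP] : forall F : {fset I}, exists f : {fset I} * nat * l1sum X,
    [/\ (F `<=` f.1.1)%fset, K f.2 &
        e / 2 <= `|g f.1.2 (l1proj f.1.1 f.2) - g f.1.2 (l1proj F f.2)|].
  move=> F; have [N _ NP] := l1proj_mackey_null F cK e40.
  have [n [x [Nn Kx ex]]] : exists n x, [/\ (N <= n)%N, K x & e < `|g n x|].
    apply: contrapT => nx; apply: ng; exists N => // n /= Nn x Kx.
    by rewrite leNgt; apply/negP => ex; apply: nx; exists n, x.
  have [G GP] : exists G : {fset I}, forall H : {fset I}, (G `<=` H)%fset ->
      `|g n x - g n (l1proj H x)| <= e / 4.
    (* Dividing by [C + 1] allows for [C = 0]. *)
    have d0 : 0 < e / 4 / (C + 1) by rewrite divr_gt0// ltr_wpDl.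
    have [G GP] := l1proj_tail x d0; exists G => H GH.
    rewrite -(dual_linearB _ _ (dg n)); apply: (le_trans (gC _ _)).
    apply: (le_trans (ler_wpM2l C0 (GP H GH))).
    rewrite mulrCA ger_pMr// ler_pdivrMr ?ltr_wpDl// mul1r lerDl//.
  exists ((F `|` G)%fset, n, x); split => //=; first exact: fsubsetUl.
  have := GP _ (fsubsetUr F G); have := NP n Nn x Kx; move: ex.
  set a := g n x; set b := g n (l1proj F x); set c := g n _ => ea be ac.
  have : `|a| <= `|a - c| + `|c - b| + `|b|.
    rewrite [X in `|X| <= _](_ : _ = (a - c) + (c - b) + b); last by ring.
    by rewrite (le_trans (ler_normD _ _))// lerD2r ler_normD.
  by move: ea be ac; lra.
pose F := fix F k := if k is k'.+1 then (f (F k')).1.1 else fset0.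
pose h j x := g (f (F j)).1.2 (l1proj (F j.+1) x) - g (f (F j)).1.2 (l1proj (F j) x).
have FS j : (F j `<=` F j.+1)%fset by case: (fP (F j)).
have hE j x : h j x = \sum_(i <- (F j.+1 `\` F j)%fset)
    g (f (F j)).1.2 (l1single (x i)).
  by rewrite /h !dual_l1projE// sum_fsetD.
have dh j : dual (h j).
  have -> : h j = (fun x => \sum_(i <- (F j.+1 `\` F j)%fset)
      g (f (F j)).1.2 (l1single (x i))) by apply/funext => x; exact: hE.
  apply: dual_sum => i.
  apply: (@dual_comp _ _ (X i) (fun x : l1sum X => x i) 1
    (fun t => g (f (F j)).1.2 (l1single t))).
  - exact: l1sum_coord_linear.
  - by move=> x; exact: (@l1sum_coord_le R I X x i).
  - exact: dual_l1single.
(* Differences of successive [F j] are disjoint, so the bounds of different [h j] use different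
   coordinates of [x]. *)
have hC x n : \sum_(0 <= j < n) `|h j x| <= C * `|x|.
  apply: (@le_trans _ _ (C * \sum_(i <- F n) `|x i|)); last first.
    by rewrite ler_wpM2l// sum_norm_le_l1sum.
  elim: n => [|n IHn]; first by rewrite big_geq// mulr_ge0// sumr_ge0.
  rewrite big_nat_recr//= -[leRHS](subrK (C * \sum_(i <- F n) `|x i|)) addrC lerD//.
  rewrite -mulrBr -sum_fsetD// hE (le_trans (ler_norm_sum _ _ _))//.
  rewrite mulr_sumr; apply: ler_sum => i _; apply: (le_trans (gC _ _)).
  by rewrite ler_wpM2l// -[leRHS]mul1r l1single_norm_le.
have [N _ NP] := summable_mackey_null dh hC cK e40.
have [_ Kx] := fP (F N); have := NP N (leqnn N) _ Kx.
rewrite /h/=; lra.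
Qed.

End l1sum_mackey_null.

(** * Pseudo-intersections *)

(** The only place where the minimality of [frakp] enters. Codes by [pickle] turn subsets of the
    countable type [T] into sets of naturals. *)
Lemma pseudo_intersection (I : choiceType) (T : countType) (D : nat -> set T)
    (B : I -> set T) : card_lt [set: I] frakp ->
  (forall n, D n.+1 `<=` D n) -> (forall t, exists n, ~ D n t) ->
  (forall (F : {fset I}) n, exists2 t, D n t & forall i, i \in F -> B i t) ->
  exists2 s : nat -> T, forall n, D n (s n) &
    forall i, \forall n \near \oo, B i (s n).
Proof.
move=> /andP[_ Ip] DS D0 fip.
have Dmon m n : (m <= n)%N -> D n `<=` D m.
  move=> /subnKC <-; elim: (n - m)%N => [|k IHk]; rewrite ?addn0// addnS.
  by move=> t /DS/IHk.
(* For finite [I] all the [B i] are met at once; the rest uses an infinite [I] to index the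
   [D n]. *)
have [finI|infI] := pselect (finite_set [set: I]).
  have /choice[s sP] : forall n, exists t, D n t /\ forall i, B i t.
    move=> n; have [t Dt Bt] := fip (fset_set [set: I]) n; exists t; split=> // i.
    by apply: Bt; rewrite in_fset_set// inE.
  exists s => [n|i]; first by have [] := sP n.
  by apply: nearW => n; have [] := sP n.
(* Intersecting [B i] with [D (e i)], where [e] is onto [nat], makes every
   pseudo-intersection meet all the [D n] without enlarging the family. *)
have /infiniteP/pcard_surjP[e esurj] := infI.
(* Each element leaves the [D n] eventually, hence so do, together, the finitely many elements coded
   in [Q]. A set of codes that meets every [D n] is therefore infinite. *)
have avoid (Q : set nat) : finite_set Q ->
    exists N, forall t : T, Q (choice.pickle t) -> ~ D N t.
  move=> /finite_fsetP[G ->].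
  have /choice[k kP] : forall m, exists n, forall t : T, choice.pickle t = m -> ~ D n t.
    move=> m; have [[t tm]|nt] := pselect (exists t : T, choice.pickle t = m).
      have [n nD] := D0 t; exists n => t'.
      by rewrite -tm => /(pcan_inj choice.pickleK) ->.
    by exists 0%N => t tm; case: nt; exists t.
  exists (\max_(m <- G) k m) => t /= tG /Dmon Dt.
  by apply: (kP _ t erefl); apply: Dt; exact: leq_bigmax_seq.
pose M i : set nat := [set m | exists2 t, B i t /\ D (e i) t & choice.pickle t = m].
have MP i t : M i (choice.pickle t) -> B i t /\ D (e i) t.
  by move=> [u Bu] /(pcan_inj choice.pickleK) <-.
have fipM (N : set (set nat)) : N `<=` range M -> finite_set N ->
    infinite_set (\bigcap_(Q in N) Q).
  move=> NM finN /avoid[k kP].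
  have /choice[g gP] : forall Q, exists i, N Q -> M i = Q.
    move=> Q; have [/NM[i _ iQ]|nQ] := pselect (N Q); first by exists i.
    by have [i _ _] := esurj 0%N Logic.I; exists i.
  have finF : finite_set [set g Q | Q in N] by exact: finite_image.
  pose F := fset_set [set g Q | Q in N].
  have [t Dt Bt] := fip F (maxn k (\max_(i <- F) e i)).
  apply: (kP t); last by apply: Dmon Dt; exact: leq_maxl.
  move=> Q NQ; rewrite -(gP Q NQ); exists t => //.
  have gF : g Q \in F by rewrite in_fset_set// inE; exists Q.
  split; first exact: Bt.
  by apply: Dmon Dt; rewrite leq_max (leq_bigmax_seq _ gF)// orbT.
(* Otherwise [range M] would be a [p_family], and [frakp] would have at most as many elements as
   [I]. *)
have [A infA AM] : exists2 A, infinite_set A &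
    forall Q, range M Q -> finite_set (A `\` Q).
  apply: contrapT => nA; move/negP: Ip; apply.
  apply: (@card_le_trans _ _ _ (range M)); last exact: card_image_le.
  apply: (frakpP.2); split => // Q MQ.
  have := fipM [set Q] _ (finite_set1 Q); rewrite bigcap_set1; apply.
  by move=> _ ->.
(* With [e i = n], all but finitely many elements of [A] code elements of [D n]. *)
have /choice[s sP] : forall n, exists t, D n t /\ A (choice.pickle t).
  move=> n; have [i _ ein] := esurj n Logic.I.
  have /(infinite_setD infA)/infinite_setN0[m] : finite_set (A `\` M i).
    by apply: AM; exists i.
  move=> [Am]; rewrite /= not_andE => -[//|/contrapT [t [_ Dt] tm]].
  by exists t; rewrite tm -ein.
exists s => [n|i]; first by have [] := sP n.
have /avoid[N NP] : finite_set (A `\` M i) by apply: AM; exists i.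
exists N => // n /= Nn; have [Dn An] := sP n.
have [/MP[]//|nM] := pselect (M i (choice.pickle (s n))).
by case: (NP (s n)) => //; exact: Dmon Dn.
Qed.

(** Round the weights up to rationals by less than [d], then divide by their sum, which lies between
    1 and [1 + k * d]. The error is at most [k * d + d = e]. *)
Lemma rat_convex_approx (R : realType) (J : {fset nat}) (a : nat -> R) (e : R) :
  0 < e -> (forall n, 0 <= a n) -> \sum_(n <- J) a n = 1 ->
  exists b : nat -> rat, [/\ forall n, 0 <= b n, \sum_(n <- J) b n = 1 &
    forall n, n \in J -> `|a n - ratr (b n)| <= e].
Proof.
move=> e0 a0 a1; set k : R := (#|` J|)%:R.
have d0 : 0 < e / (k + 1) by rewrite divr_gt0// ltr_wpDl.
set d := e / (k + 1) in d0.
have /choice[r rP] : forall n, exists q : rat, a n < ratr q < a n + d.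
  move=> n; have [|q] := @rat_in_itvoo R (a n) (a n + d); first by rewrite ltrDl.
  by rewrite in_itv => qP; exists q.
pose s := \sum_(n <- J) r n.
have r0 n : 0 <= r n.
  by rewrite -(ler0q R) (le_trans (a0 n))// ltW//; case/andP: (rP n).
have sE : ratr s = \sum_(n <- J) (ratr (r n) : R) by rewrite rmorph_sum.
have s1 : 1 <= (ratr s : R).
  by rewrite sE -a1; apply: ler_sum => n _; rewrite ltW//; case/andP: (rP n).
have sk : (ratr s : R) <= 1 + k * d.
  rewrite sE -a1 mulrC; apply: (@le_trans _ _ (\sum_(n <- J) (a n + d))).
    by apply: ler_sum => n _; rewrite ltW//; case/andP: (rP n).
  by rewrite big_split/= big_const_seq count_predT iter_addr_0 mulr_natr.
have s0 : 0 < (ratr s : R) by exact: lt_le_trans s1.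
exists (fun n => r n / s); split=> [n||n nJ].
- by rewrite divr_ge0// sumr_ge0.
- by rewrite -mulr_suml divff// -(fmorph_eq0 (@ratr R)) gt_eqF.
- have /andP[anr rnd] := rP n; rewrite fmorph_div/=.
  set x : R := ratr (r n) in anr rnd *; set S : R := ratr s in s1 sk s0 *.
  have xS : x <= S.
    rewrite /S sE (big_fsetD1 n nJ)/= lerDl sumr_ge0// => m _.
    by rewrite ler0q.
  have x0 : 0 <= x by rewrite ler0q.
  have y0 : x / S <= 1 by rewrite ler_pdivrMr// mul1r.
  have yx : x / S <= x by rewrite ler_pdivrMr// ler_peMr.
  have xy : x - x / S = x / S * (S - 1).
    by rewrite mulrBr mulr1 divfK// gt_eqF.
  have xyle : x - x / S <= k * d.
    rewrite xy (@le_trans _ _ (S - 1))//; last by lra.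
    by rewrite ler_piMl// subr_ge0.
  have kd : k * d + d = e.
    rewrite -[X in _ + X]mul1r -mulrDl mulrC divfK//.
    by rewrite gt_eqF// ltr_wpDl.
  rewrite ler_norml; apply/andP; split; lra.
Qed.

(** * Rational convex combinations *)

Section convex_polynomials.
Implicit Types p : {poly rat}.

(* [p] encodes the convex weights [p`_m], supported in [n, +oo[. *)
Definition cvx_poly n : set {poly rat} :=
  [set p : {poly rat} | [/\ forall m, 0 <= p`_m, p.[1] = 1 &
    forall m, (m < n)%N -> p`_m = 0]].

Lemma cvx_polyS n : cvx_poly n.+1 `<=` cvx_poly n.
Proof. by move=> p [p0 p1 pn]; split=> // m mn; apply: pn; exact: leqW. Qed.

Lemma cvx_poly_le m n : (m <= n)%N -> cvx_poly n `<=` cvx_poly m.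
Proof.
by move=> mn p [p0 p1 pn]; split=> // k km; apply: pn; exact: leq_trans mn.
Qed.

Lemma cvx_poly_size n p : cvx_poly n p -> (n < size p)%N.
Proof.
move=> [_ p1 pn]; rewrite ltnNge; apply/negP => np.
suff p0 : p = 0 by move: p1; rewrite p0 horner0 => /eqP; rewrite eq_sym oner_eq0.
apply/polyP => m; rewrite coef0; have [mn|nm] := ltnP m n; first exact: pn.
by rewrite nth_default// (leq_trans np).
Qed.

Lemma cvx_polyXn n : cvx_poly n 'X^n.
Proof.
split=> [m||m mn]; first by rewrite coefXn ler0n.
  by rewrite hornerXn expr1n.
by rewrite coefXn ltn_eqF.
Qed.

Lemma cvx_poly_sum n (J : {fset nat}) (b : nat -> rat) (p : nat -> {poly rat}) :
  (forall j, 0 <= b j) -> \sum_(j <- J) b j = 1 ->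
  (forall j, j \in J -> cvx_poly n (p j)) ->
  cvx_poly n (\sum_(j <- J) b j *: p j).
Proof.
move=> b0 b1 pn; split.
- move=> m; rewrite coef_sum big_seq sumr_ge0// => j /pn[p0 _ _].
  by rewrite coefZ mulr_ge0.
- rewrite horner_sum -[RHS]b1 [in LHS]big_seq [in RHS]big_seq.
  apply: eq_bigr => j /pn[_ p1 _].
  by rewrite hornerZ p1 mulr1.
- move=> m mn; rewrite coef_sum big_seq big1// => j /pn[_ _ p0].
  by rewrite coefZ p0// mulr0.
Qed.

Variables (R : realType) (Y : Type).
Implicit Types u : nat -> Y -> R.

Definition peval u p y : R := \sum_(0 <= m < size p) ratr p`_m * u m y.

Lemma peval_widen u p y N : (size p <= N)%N ->
  peval u p y = \sum_(0 <= m < N) ratr p`_m * u m y.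
Proof.
move=> pN; rewrite /peval [RHS](big_cat_nat (leq0n _) pN)/=.
rewrite [X in _ = _ + X]big_nat_cond [X in _ = _ + X]big1 ?addr0// => m.
by rewrite andbT => /andP[pm _]; rewrite nth_default// rmorph0 mul0r.
Qed.

Lemma peval_sum u (J : {fset nat}) (b : nat -> rat) (p : nat -> {poly rat}) y :
  peval u (\sum_(j <- J) b j *: p j) y = \sum_(j <- J) ratr (b j) * peval u (p j) y.
Proof.
pose N := maxn (size (\sum_(j <- J) b j *: p j)) (\max_(j <- J) size (p j)).
rewrite (@peval_widen _ _ _ N) ?leq_maxl//.
transitivity (\sum_(j <- J) \sum_(0 <= m < N) ratr (b j) * (ratr (p j)`_m * u m y)).
  rewrite exchange_big/=; apply: eq_bigr => m _.
  rewrite coef_sum rmorph_sum mulr_suml; apply: eq_bigr => j _.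
  by rewrite coefZ rmorphM/= mulrA.
rewrite big_seq [RHS]big_seq; apply: eq_bigr => j jJ.
rewrite -mulr_sumr (@peval_widen _ _ _ N)// leq_max.
by apply/orP; right; exact: leq_bigmax_seq.
Qed.

Lemma peval_le u p y n (e : R) : cvx_poly n p ->
  (forall m, (n <= m)%N -> `|u m y| <= e) -> `|peval u p y| <= e.
Proof.
move=> [p0 p1 pn] ue; apply: (le_trans (ler_norm_sum _ _ _)).
have -> : e = \sum_(0 <= m < size p) ratr p`_m * e.
  rewrite -mulr_suml -rmorph_sum big_mkord.
  have -> : \sum_(i < size p) p`_i = 1.
    by rewrite -p1 horner_coef; apply: eq_bigr => i _; rewrite expr1n mulr1.
  by rewrite rmorph1 mul1r.
apply: ler_sum => m _; rewrite normrM ger0_norm ?ler0q//.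
have [mn|nm] := ltnP m n; first by rewrite pn// rmorph0 !mul0r.
by rewrite ler_wpM2l ?ler0q// ue.
Qed.

Lemma peval_cvg0 u (s : nat -> {poly rat}) y : (forall n, cvx_poly n (s n)) ->
  u n y @[n --> \oo] --> 0 -> peval u (s n) y @[n --> \oo] --> 0.
Proof.
move=> sn /cvgr0Pnorm_le u0; apply/cvgr0Pnorm_le => e e0.
have [N _ NP] := u0 e e0; exists N => // n /= Nn.
by apply: (peval_le (sn n)) => m nm; apply: NP => /=; exact: leq_trans nm.
Qed.

End convex_polynomials.

Lemma dual_peval (R : realType) (X : normedModType R) (u : nat -> X -> R)
  (p : {poly rat}) : (forall n, dual (u n)) -> dual (peval u p).
Proof. by move=> du; apply: dual_sum => n; exact: dualZ. Qed.

Lemma mackey_cvgE (R : realType) (X : normedModType R) (y : nat -> X -> R)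
    (f : X -> R) : {family @weakly_compact R X, y @ \oo --> f} <->
  mackey_null (fun n x => y n x - f x).
Proof.
split=> [yf K cK e e0|yf].
  have /fam_cvgP/(_ K cK) yK := yf.
  have : nbhs (f : {uniform` K -> R}) [set h | forall x, K x -> ball (f x) e (h x)].
    apply/uniform_nbhs; exists [set xy | ball xy.1 e xy.2]; split => //.
    exact: entourage_ball (PosNum e0).
  move=> /yK yN; have {}yN : \forall n \near \oo, forall x, K x ->
      ball (f x) e (y n x) by exact: yN.
  apply: filterS yN => n yn x Kx.
  by have := yn x Kx; rewrite -ball_normE/= distrC => /ltW.
apply/fam_cvgP => K cK A /uniform_nbhs[E [entE EA]].
have [e /= e0 eE] : exists2 e : R, 0 < e & forall a b, ball a e b -> E (a, b).
  move: entE; rewrite -entourage_ballE => -[e /= e0 eE]; exists e => // a b ab.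
  exact: (eE (a, b)).
have e20 : 0 < e / 2 by rewrite divr_gt0.
have := yf K cK _ e20; apply: filterS => n yn; apply: EA => x Kx.
apply: eE; rewrite -ball_normE /= distrC (le_lt_trans (yn x Kx))//.
by rewrite ltr_pdivrMr// ltr_pMr// ltr1n.
Qed.

(** * Selection of Mackey-null convex blocks *)

Section mackey_good.
Variables (R : realType) (X : completeNormedModType R) (v : nat -> X -> R).

(* The first clause is what keeps convex blocks of elements of [M] in [M]. *)
Definition mackey_good (M : set {poly rat}) : Prop :=
  (forall (J : {fset nat}) (b : nat -> rat) (p : nat -> {poly rat}),
    (forall j, 0 <= b j) -> \sum_(j <- J) b j = 1 ->
    (forall j, j \in J -> M (p j)) -> M (\sum_(j <- J) b j *: p j)) /\
  (forall K, weakly_compact K -> forall e : R, 0 < e -> exists N,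
    forall p, M p -> cvx_poly N p -> forall x, K x -> `|peval v p x| <= e).

(** [M] consists of the convex polynomials that inherit every bound shared by all the [q k]; it
    contains their convex combinations without describing them. *)
Lemma mackey_good_hull (q : nat -> {poly rat}) :
  (forall k, cvx_poly k (q k)) -> mackey_null (fun k => peval v (q k)) ->
  exists2 M, mackey_good M & forall k, M (q k).
Proof.
move=> qk q0; pose bounded_by (K : set X) (e : R) N p :=
  cvx_poly N p -> forall x, K x -> `|peval v p x| <= e.
exists (fun p => cvx_poly 0 p /\ forall K e N,
    (forall k, bounded_by K e N (q k)) -> bounded_by K e N p); last first.
  by move=> k; split=> [|K e N]; [exact: cvx_poly_le (qk k)|exact].
split=> [J b p b0 b1 pM|K cK e e0].
  split=> [|K e N qb [_ _ pN] x Kx].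
    by apply: cvx_poly_sum => // j /pM[].
  rewrite peval_sum (le_trans (ler_norm_sum _ _ _))//.
  have -> : e = \sum_(j <- J) ratr (b j) * e.
    by rewrite -mulr_suml -rmorph_sum b1 rmorph1 mul1r.
  rewrite big_seq [leRHS]big_seq; apply: ler_sum => j jJ.
  have [[pj0 pj1 _] pjb] := pM j jJ.
  rewrite normrM ger0_norm ?ler0q//.
  (* A term of positive weight is supported beyond [N] along with the combination, since nonnegative
     coefficients do not cancel. *)
  have [->|bj0] := eqVneq (b j) 0; first by rewrite rmorph0 !mul0r.
  rewrite ler_wpM2l ?ler0q// (pjb K e N)//; split => // m mN.
  have := pN m mN; rewrite coef_sum (big_fsetD1 j jJ)/= => /eqP.
  rewrite paddr_eq0; last 2 first.
  - by rewrite coefZ mulr_ge0.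
  - rewrite big_seq sumr_ge0// => i; rewrite inE => /andP[_ /pM[[pi0 _ _] _]].
    by rewrite coefZ mulr_ge0.
  by rewrite coefZ mulf_eq0 (negbTE bj0) => /andP[/eqP].
have [k0 _ k0P] := q0 K cK e e0.
(* The [q k] with [k < k0] are too short to be in [cvx_poly] of this index, so the bound holds for
   them vacuously. *)
exists (\max_(k < k0) size (q k)) => p [_ pb].
apply: pb => k qN; apply: k0P => /=; rewrite leqNgt; apply/negP => kk0.
have := cvx_poly_size qN; rewrite ltnNge => /negP; apply.
exact: (leq_bigmax (Ordinal kk0)).
Qed.

Lemma sum_expr2V n : \sum_(0 <= j < n) (2^-1 : R) ^+ j.+1 = 1 - 2^-1 ^+ n.
Proof.
elim: n => [|n IHn]; first by rewrite big_geq// expr0 subrr.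
by rewrite big_nat_recr//= IHn exprS; field.
Qed.

(* Replacing the real weights [a] by rational ones [b k] costs functionals
   [h k] with [\sum_k `|h k x| <= `|x|], which are Mackey-null. *)
Lemma property_K_good (s : nat -> {poly rat}) : property_K X ->
  (forall n, dual (v n)) -> (forall x, v n x @[n --> \oo] --> 0) ->
  (forall n, cvx_poly n (s n)) ->
  exists M q, [/\ mackey_good M, forall k, M (q k), forall k, cvx_poly k (q k) &
    forall k, exists (J : {fset nat}) b, [/\ q k = \sum_(n <- J) b n *: s n,
      forall n, 0 <= b n, \sum_(n <- J) b n = 1 & forall n, n \in J -> (k <= n)%N]].
Proof.
move=> KX dv v0 sn; pose w n := peval v (s n).
have dw n : dual (w n) by exact: dual_peval.
have w0 x : w n x @[n --> \oo] --> 0 by exact: peval_cvg0.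
have [y [J [a [Jlt a0 a1 yE]]] [f df /mackey_cvgE yf]] : exists2 y,
    convex_block_subseq w y & mackey_convergent y.
  by apply: KX => //; exists (fun=> 0); [exact: dual0|exact/pointwise_cvgP].
have Jk k n : n \in J k -> (k <= n)%N.
  elim: k n => // k IHk n nJ.
  have [m mJ] : exists m, m \in J k.
    apply: contrapT => nJk; have := a1 k; rewrite big_seq big1 => [/eqP|m mJ].
      by rewrite eq_sym oner_eq0.
    by case: nJk; exists m.
  exact: leq_ltn_trans (IHk m mJ) (Jlt _ _ _ mJ nJ).
have yEx k x : y k x = \sum_(n <- J k) a n * w n x by rewrite yE fct_sumE.
have y0 x : y k x @[k --> \oo] --> 0.
  apply/cvgr0Pnorm_le => e e0; have /cvgr0Pnorm_le/(_ e e0)[N _ NP] := w0 x.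
  exists N => // k /= Nk; rewrite yEx (le_trans (ler_norm_sum _ _ _))//.
  have -> : e = \sum_(n <- J k) a n * e by rewrite -mulr_suml a1 mul1r.
  rewrite big_seq [leRHS]big_seq; apply: ler_sum => n /Jk kn.
  by rewrite normrM ger0_norm// ler_wpM2l// NP//= (leq_trans Nk).
(* Singletons are weakly compact, so [f] is also the pointwise limit of [y]. *)
have f0 x : f x = 0.
  have cx : weakly_compact [set x] by exact: (@compact_set1 (weak X)).
  have yfx : y k x @[k --> \oo] --> f x.
    apply/cvgrPdist_le => e e0; have := yf _ cx e e0.
    by apply: filterS => k; rewrite distrC; exact.
  exact: (cvg_unique _ yfx (y0 x)).
have {}yf : mackey_null y.
  by move=> K cK e e0; have := yf K cK e e0; under eq_near do
    under eq_forall do rewrite f0 subr0.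
have /choice[c cP] : forall n, exists c : R, 0 <= c /\ forall x, `|w n x| <= c * `|x|.
  move=> n; have /dualP[_ [c cw]] := dw n; exists `|c|; split => // x.
  by rewrite (le_trans (cw x))// ler_wpM2r// ler_norm.
have c0 n : 0 <= c n by case: (cP n).
(* [S k] dominates the sum of the norm bounds over the block, the [1] keeping it positive; a weight
   error of [2^-1 ^+ k.+1 / S k] then makes the [h k] summable. *)
pose S k := 1 + \sum_(n <- J k) c n.
have S0 k : 0 < S k by rewrite ltr_pwDl// sumr_ge0.
have /choice[b bP] : forall k, exists b : nat -> rat, [/\ forall n, 0 <= b n,
    \sum_(n <- J k) b n = 1 &
    forall n, n \in J k -> `|a n - ratr (b n)| <= 2^-1 ^+ k.+1 / S k].
  by move=> k; apply: rat_convex_approx => //; rewrite divr_gt0// exprn_gt0.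
pose q k := \sum_(n <- J k) b k n *: s n.
have qE k x : peval v (q k) x = \sum_(n <- J k) ratr (b k n) * w n x.
  by rewrite peval_sum.
have qk k : cvx_poly k (q k).
  have [b0 b1 _] := bP k; apply: cvx_poly_sum => // n nJ.
  exact: cvx_poly_le (Jk _ _ nJ) _ (sn n).
pose h k x := y k x - peval v (q k) x.
have hE k x : h k x = \sum_(n <- J k) (a n - ratr (b k n)) * w n x.
  by rewrite /h yEx qE -sumrB; apply: eq_bigr => n _; rewrite mulrBl.
have dh k : dual (h k).
  have -> : h k = (fun x => \sum_(n <- J k) (a n - ratr (b k n)) * w n x).
    by apply/funext => x; exact: hE.
  by apply: dual_sum => n; exact: dualZ.
have h_le k x : `|h k x| <= 2^-1 ^+ k.+1 * `|x|.
  rewrite hE (le_trans (ler_norm_sum _ _ _))//.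
  apply: (@le_trans _ _ (\sum_(n <- J k) 2^-1 ^+ k.+1 / S k * (c n * `|x|))).
    rewrite big_seq [leRHS]big_seq; apply: ler_sum => n nJ; rewrite normrM.
    have [_ _ /(_ n nJ) bn] := bP k; have [_ cw] := cP n.
    by rewrite ler_pM.
  rewrite -mulr_sumr -mulr_suml -mulrA ler_wpM2l ?exprn_ge0//.
  by rewrite ler_pdivrMl// ler_wpM2r// /S lerDr.
have hM : mackey_null h.
  apply: (@summable_mackey_null _ _ _ 1) => // x n.
  apply: (@le_trans _ _ (\sum_(0 <= j < n) 2^-1 ^+ j.+1 * `|x|)).
    by apply: ler_sum => j _; exact: h_le.
  by rewrite -mulr_suml ler_wpM2r// sum_expr2V gerBl exprn_ge0.
have qM : mackey_null (fun k => peval v (q k)).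
  move=> K cK e e0; have e20 : 0 < e / 2 by rewrite divr_gt0.
  apply: filterS2 (yf K cK _ e20) (hM K cK _ e20) => k yk hk x Kx.
  have -> : peval v (q k) x = y k x - h k x by rewrite /h; ring.
  by rewrite (le_trans (ler_normB _ _))// (splitr e) lerD ?yk ?hk.
have [M gM Mq] := mackey_good_hull qk qM.
exists M, q; split => // k; exists (J k), (b k); split => //.
- by case: (bP k).
- by case: (bP k).
- exact: Jk.
Qed.

End mackey_good.

(** * Common blocks for all the summands, by Zorn's lemma *)

Lemma common_convex_blocks (R : realType) (I : choiceType)
    (X : I -> completeNormedModType R) (v : forall i, nat -> X i -> R) :
  card_lt [set: I] frakp -> (forall i, property_K (X i)) ->
  (forall i n, dual (v i n)) -> (forall i x, v i n x @[n --> \oo] --> 0) ->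
  exists2 s, forall n, cvx_poly n (s n) &
    forall i, mackey_null (fun n => peval (v i) (s n)).
Proof.
move=> Ip XK dv v0.
pose fip (S : set (I * set {poly rat})) := forall (L : seq (I * set {poly rat})) n,
  (forall c, c \in L -> S c) -> exists2 p, cvx_poly n p & forall c, c \in L -> c.2 p.
(* [S] is the graph of a partial assignment of good sets to indices. *)
pose P S := [/\ forall c, S c -> mackey_good (v c.1) c.2,
  forall i M M', S (i, M) -> S (i, M') -> M = M' & fip S].
have D0 p : exists n, ~ cvx_poly n p.
  by exists (size p) => /cvx_poly_size; rewrite ltnn.
have seqP S : P S -> exists2 s, forall n, cvx_poly n (s n) &
    forall c, S c -> \forall n \near \oo, c.2 (s n).
  move=> [_ Sfun Sfip].
  have [|s sn sB] := pseudo_intersection (B := fun i p => forall M, S (i, M) -> M p)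
      Ip cvx_polyS D0.
    (* The default [setT] stands for indices without an assigned set; [L] drops the pairs that are
       not in [S]. *)
    move=> F n; pose c i := (i, xget setT [set M | S (i, M)]).
    pose L := [seq d <- [seq c i | i <- F] | `[< S d >]].
    have [|p pn pL] := Sfip L n.
      by move=> d; rewrite mem_filter => /andP[/asboolP].
    exists p => // i iF M SM; have := pL (i, M); apply.
    rewrite mem_filter; apply/andP; split; first exact/asboolP.
    apply/mapP; exists i => //; rewrite /c; congr (_, _).
    by case: xgetP => [M' -> /Sfun/(_ SM)|/(_ M)].
  exists s => // -[i M] SM; apply: filterS (sB i) => n; exact.
have [F FP totF|S [SP Smax]] := @Zorn_bigcup _ P.
  split=> [c [S FS Sc]|i M M' [S FS SM] [S' FS' SM']|].
  - by have [/(_ c Sc)] := FP _ FS.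
  - have [SS'|S'S] := totF _ _ FS FS'.
      by have [_ Sfun _] := FP _ FS'; apply: (Sfun i) => //; exact: SS'.
    by have [_ Sfun _] := FP _ FS; apply: (Sfun i) => //; exact: S'S.
  - move=> L n LF; have [L0|[S FS LS]] :
        L = [::] \/ exists2 S, F S & forall c, c \in L -> S c.
      elim: L LF => [|c L IHL] LF; [by left|right].
      have [S FS Sc] := LF c (mem_head _ _).
      have [|->|[S' FS' LS']] := IHL.
      + by move=> d dL; apply: LF; rewrite inE dL orbT.
      + by exists S => // d; rewrite inE => /eqP ->.
      have [SS'|S'S] := totF _ _ FS FS'.
        exists S' => // d; rewrite inE => /predU1P[->|/LS']//; exact: SS'.
      by exists S => // d; rewrite inE => /predU1P[->//|/LS' /S'S].
    + by exists 'X^n; [exact: cvx_polyXn|rewrite L0].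
    + by have [_ _ Sfip] := FP _ FS; exact: Sfip.
have [s sn sS] := seqP _ SP.
suff Stot i : exists M, S (i, M).
  exists s => // i K cK e e0; have [M SM] := Stot i.
  have [/(_ _ SM)[/= _ Mgood] _ _] := SP.
  have [N NP] := Mgood K cK e e0.
  apply: filterS2 (sS _ SM) (nbhs_infty_ge N) => n sM /= Nn x Kx.
  by apply: NP => //; exact: cvx_poly_le Nn _ (sn n).
apply: contrapT => ni.
(* The new set for the missing [i] is built from blocks [q k] of [s], which is eventually in every
   set assigned so far. *)
have [M [q [gM Mq qk qs]]] := property_K_good (XK i) (dv i) (v0 i) sn.
apply: (Smax (S `|` [set (i, M)])).
  by split => [|/(_ (i, M) (or_intror erefl)) SM]; [exact: subsetUl|apply: ni; exists M].
have [Sgood Sfun _] := SP; split.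
- by move=> c [/Sgood//|->].
- move=> j M1 M2 [S1|[ji ->]] [S2|[ji' ->]] //; first exact: Sfun S1 S2.
    by case: ni; exists M1; rewrite -ji'.
  by case: ni; exists M2; rewrite -ji.
move=> L n LS.
have : \forall k \near \oo, forall c, c \in L -> c.2 (q k).
  elim: L LS => [|c L IHL] LS; first exact: nearW.
  have Lq : \forall k \near \oo, forall c, c \in L -> c.2 (q k).
    by apply: IHL => d dL; apply: LS; rewrite inE dL orbT.
  (* [q k] combines only [s m] with [k <= m]; for large [k] these lie in [c.2], which is closed
     under convex combinations. *)
  have cq : \forall k \near \oo, c.2 (q k).
    have [Sc|->] := LS c (mem_head _ _); last by apply: nearW => k; exact: Mq.
    have [N _ NP] := sS c Sc; exists N => // k /= Nk.
    have [J [b [-> b0 b1 kJ]]] := qs k.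
    have [closed_c _] := Sgood c Sc; apply: closed_c => // m mJ.
    by apply: NP => /=; exact: leq_trans Nk (kJ m mJ).
  by apply: filterS2 cq Lq => k cq Lq d; rewrite inE => /predU1P[->|/Lq].
move=> [N _ NP]; exists (q (maxn N n)); last exact/NP/leq_maxl.
exact: cvx_poly_le (leq_maxr N n) _ (qk _).
Qed.

(** * Back to blocks of the original sequence *)

Lemma convex_block_subseq_peval (R : realType) (Y : Type) (x : nat -> Y -> R)
    (f : Y -> R) (q : nat -> {poly rat}) (t : nat -> nat) :
  (forall k, cvx_poly (t k) (q k)) -> (forall k, (size (q k) <= t k.+1)%N) ->
  convex_block_subseq x
    (fun k y => peval (fun n y => x n y - f y) (q k) y + f y).
Proof.
move=> qt qS.
have tS k : (t k < t k.+1)%N by exact: leq_trans (cvx_poly_size (qt k)) (qS k).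
have tmon j k : (j <= k)%N -> (t j <= t k)%N.
  move=> /subnKC <-; elim: (k - j)%N => [|m IHm]; rewrite ?addn0// addnS.
  by rewrite (leq_trans IHm)// ltnW.
pose J k := [fset n in iota 0 (size (q k)) | (q k)`_n != 0]%fset.
have JE k n : (n \in J k) = ((q k)`_n != 0).
  rewrite !inE mem_iota add0n /= andb_idl// => qn.
  by rewrite ltnNge; apply: contraNN qn => qn; rewrite nth_default.
have Jt k n : n \in J k -> (t k <= n < t k.+1)%N.
  rewrite JE => qn; have [_ _ qk] := qt k; apply/andP; split.
    by rewrite leqNgt; apply: contraNN qn => /qk ->.
  apply: leq_trans (qS k); rewrite ltnNge.
  by apply: contraNN qn => qn; rewrite nth_default.
(* The supports lie in the disjoint intervals from [t k] to [t k.+1], so one weight sequence serves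
   all blocks; it is 0 off the supports. *)
have /choice[a aP] : forall n, exists a : R, 0 <= a /\
    forall k, n \in J k -> a = ratr (q k)`_n.
  move=> n; have [[k nk]|nJ] := pselect (exists k, n \in J k); last first.
    by exists 0; split => // k nk; case: nJ; exists k.
  exists (ratr (q k)`_n); split=> [|j nj].
    by rewrite ler0q; case: (qt k).
  have /andP[kn nk1] := Jt _ _ nk; have /andP[jn nj1] := Jt _ _ nj.
  suff -> : j = k by [].
  have [jk|kj|//] := ltngtP j k.
    by have := leq_trans nj1 (leq_trans (tmon _ _ jk) kn); rewrite ltnn.
  by have := leq_trans nk1 (leq_trans (tmon _ _ kj) jn); rewrite ltnn.
have sumJ k (g : nat -> R) :
    \sum_(n <- J k) a n * g n = \sum_(0 <= n < size (q k)) ratr (q k)`_n * g n.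
  transitivity (\sum_(n <- J k) ratr (q k)`_n * g n).
    by rewrite big_seq [RHS]big_seq; apply: eq_bigr => n /((aP n).2) ->.
  rewrite (big_fset_incl _ (B := [fset n in iota 0 (size (q k))]%fset)).
  - rewrite /index_iota subn0; apply: perm_big; apply: uniq_perm => //.
      exact: iota_uniq.
    by move=> n; rewrite !inE.
  - by apply/fsubsetP => n; rewrite !inE => /andP[].
  - by move=> n _; rewrite JE negbK => /eqP ->; rewrite rmorph0 mul0r.
have sum1 k : \sum_(n <- J k) a n = 1.
  under eq_bigr do rewrite -[a _]mulr1; rewrite sumJ -mulr_suml mulr1.
  have [_ qk1 _] := qt k; transitivity (ratr (q k).[1] : R); last first.
    by rewrite qk1 rmorph1.
  rewrite horner_coef rmorph_sum big_mkord.
  by apply: eq_bigr => n _; rewrite expr1n mulr1.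
exists J, a; split => //.
- move=> k m n /Jt/andP[_ mk] /Jt/andP[kn _]; exact: leq_trans kn.
- by move=> n; case: (aP n).
(* As the weights add up to 1, [f y] enters the sum and cancels. *)
- move=> k; rewrite fct_sumE; apply/funext => y.
  rewrite /peval -sumJ -[X in _ + X]mul1r -(sum1 k) mulr_suml -big_split/=.
  by apply: eq_bigr => n _; rewrite -mulrDr subrK.
Qed.

Theorem theorem2p14 (R : realType) (I : choiceType)
    (X : I -> completeNormedModType R)
    (hX : forall i : I, property_K (X i))
    (hI : card_lt [set: I] frakp) :
  property_K (l1sum X).
Proof.
move=> x dx [f df /pointwise_cvgP xf].
pose u n z := x n z - f z.
have du n : dual (u n) by exact: dualB.
have u0 z : u n z @[n --> \oo] --> 0.
  by rewrite -(subrr (f z)); apply: cvgB; [exact: xf|exact: cvg_cst].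
pose v i n (t : X i) := u n (l1single t).
have dv i n : dual (v i n) by exact: dual_l1single.
have [s sn sv] := common_convex_blocks hI hX dv (fun i t => u0 (l1single t)).
(* Each polynomial starts beyond the degree of the previous one; [(t k').+1] gives [k <= t k]. *)
pose t := fix t k := if k is k'.+1 then maxn (t k').+1 (size (s (t k'))) else 0%N.
have kt k : (k <= t k)%N by elim: k => // k IHk /=; rewrite leq_max ltnS IHk.
pose g k := peval u (s (t k)).
have g0 : mackey_null g.
  apply: l1sum_mackey_null => [k|z|i K cK e e0].
  - exact: dual_peval.
  - by apply: peval_cvg0 => // n; exact: cvx_poly_le (kt n) _ (sn _).
  - have [N _ NP] := sv i K cK e e0; exists N => // k /= Nk.
    by apply: NP => /=; exact: leq_trans (kt k).
exists (fun k z => g k z + f z).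
  by apply: (@convex_block_subseq_peval _ _ _ _ _ t) => // k; exact: leq_maxr.
exists f => //; apply/mackey_cvgE => K cK e e0.
by have := g0 K cK e e0; apply: filterS => k gk z /gk; rewrite addrK.
Qed.
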